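(* Every counter language is context-sensitive. That is, for every integer $k\ge 1$ and every finite set $\Sigma$, the language of every $\mathbb Z^k$-automaton over $\Sigma$ is context-sensitive.
   Context: $G$-automaton: let $G$ be a group and $\Sigma$ a finite set, and write $\Sigma^{\pm1}$ for the letters of $\Sigma$ together with their formal inverses. A (non-deterministic) $G$-automaton $A_G$ over $\Sigma$ is a finite directed graph with a distinguished start vertex $q_0$, some distinguished accept vertices, and edges labeled by elements of $(\Sigma^{\pm1}\cup\{\epsilon\})\times G$, where $\epsilon$ is the empty word. For a directed path $p$ in $A_G$, $w(p)\in(\Sigma^{\pm1})^*$ is the concatenation of the first components of its edge labels, and $g(p)\in G$ is the product, in order, of the second components; for the empty path, $w(p)$ is the empty word and $g(p)$ is the identity. The automaton accepts a word $w\in(\Sigma^{\pm1})^*$ if there is a path $p$ from $q_0$ to some accept vertex with $w(p)=w$ and $g(p)$ equal to the identity of $G$. The language of $A_G$ is the set of words it accepts. Counter language: a language is $k$-counter if it is accepted by some $\mathbb Z^k$-automaton, and it is counter if it is $k$-counter for some $k\ge1$. Context-sensitive: a language is context-sensitive if it is accepted by a (non-deterministic) linear bounded automaton, i.e. a Turing machine using a number of tape squares at most a constant multiple of the length of the input string; languages containing the empty word are allowed. *)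

(* Defs.v *)
From Stdlib Require Export Relation_Operators.
From HB Require Import structures.
From mathcomp Require Export all_boot all_algebra.

Set Implicit Arguments.
Unset Strict Implicit.
Unset Printing Implicit Defensive.

Definition language (A : Type) := seq A -> Prop.

(* The alphabet of letters [inl s] and formal inverses [inr s]. *)
Definition pm (S : finType) : finType := (S + S)%type.

(* The graph may have loops and parallel edges. [elabel] and [eweight] are the
   two components of an edge label; [None] is the empty word. *)
Record g_automaton (G : groupType) (S : finType) := GAutomaton {
  vertex : finType;
  edge : finType;
  esrc : edge -> vertex;
  edst : edge -> vertex;
  elabel : edge -> option (pm S);
  eweight : edge -> G;
  gstart : vertex;
  gaccept : {set vertex}
}.

Section GAutomaton.
Variables (G : groupType) (S : finType) (A : g_automaton G S).

Fixpoint is_path (q : vertex A) (p : seq (edge A)) (q' : vertex A) : bool :=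
  if p is e :: p' then (esrc e == q) && is_path (edst e) p' q' else q == q'.

Definition path_word (p : seq (edge A)) : seq (pm S) :=
  pmap (@elabel _ _ A) p.

Definition path_weight (p : seq (edge A)) : G :=
  (\prod_(e <- p) eweight e)%g.

Definition g_lang : language (pm S) := fun w =>
  exists p q, [/\ q \in gaccept A, is_path (gstart A) p q,
                  path_word p = w & path_weight p = 1%g].

End GAutomaton.

(* The additive group Z^k, as a multiplicatively written group. *)
Definition Zpow (k : nat) : groupType := GRing.to_multiplicative 'rV[int]_k.

Definition k_counter (k : nat) (S : finType) (L : language (pm S)) : Prop :=
  exists A : g_automaton (Zpow k) S, forall w, L w <-> g_lang A w.

Definition counter (S : finType) (L : language (pm S)) : Prop :=
  exists k, 1 <= k /\ k_counter k L.

Inductive move := MoveLeft | Stay | MoveRight.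

(* A non-deterministic one-tape Turing machine with input alphabet [A]:
   [trans q a (q', b, m)] means that in state [q] reading [a] the machine may
   enter [q'], write [b] and move the head by [m]. *)
Record turing_machine (A : finType) := TuringMachine {
  state : finType;
  symbol : finType;
  blank : symbol;
  inp : A -> symbol;
  inp_inj : injective inp;
  inp_blank : forall a, inp a != blank;
  init_state : state;
  final : {set state};
  trans : state -> symbol -> state * symbol * move -> bool
}.

Section Turing.
Variables (A : finType) (M : turing_machine A).

(* The tape is infinite in both directions. Only the squares that held the
   input or were visited by the head are stored; all the others are blank.
   [left_of] is listed from the head outwards. *)
Record config := Config {
  cur_state : state M;
  left_of : seq (symbol M);
  scanned : symbol M;
  right_of : seq (symbol M)
}.

Definition squares (c : config) : nat :=
  size (left_of c) + 1 + size (right_of c).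

Definition init_config (w : seq A) : config :=
  let t := map (@inp _ M) w in
  Config (init_state M) [::] (head (blank M) t) (behead t).

Definition update (c : config) (q : state M) (b : symbol M) (m : move)
    : config :=
  let l := left_of c in
  let r := right_of c in
  match m with
  | MoveLeft => Config q (behead l) (head (blank M) l) (b :: r)
  | Stay => Config q l b r
  | MoveRight => Config q (b :: l) (head (blank M) r) (behead r)
  end.

Definition step (c c' : config) : Prop :=
  exists q b m, trans (cur_state c) (scanned c) (q, b, m)
                /\ c' = update c q b m.

Definition reachable (w : seq A) (c : config) : Prop :=
  clos_refl_trans config step (init_config w) c.

Definition tm_lang : language A := fun w =>
  exists c, reachable w c /\ cur_state c \in final M.

(* The bound holds on every computation, accepting or not. The maximum with 1
   only matters for the empty input, on which the head still scans a square. *)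
Definition linear_bounded : Prop :=
  exists C, forall w c, reachable w c -> squares c <= C * maxn 1 (size w).

End Turing.

Definition context_sensitive (A : finType) (L : language A) : Prop :=
  exists M : turing_machine A,
    linear_bounded M /\ forall w, L w <-> tm_lang M w.

(* Main.v *)
From HB Require Import structures.
From mathcomp Require Import all_order boolp zify.
Require Import Defs.

(** Removing silent loops from an accepting path, without losing any of its
    vertices, leaves a skeleton of length linear in the input, plus loops of
    bounded length which can be reinserted in any number. The numbers of uses of
    the skeleton edges and of the loops solve a homogeneous linear system, whose
    minimal solutions are finitely many by Dickson's lemma; discarding from a
    solution the minimal ones without skeleton edge leaves linearly many loops.
    Hence an accepted word has an accepting path of linear length.

    A linear bounded automaton can then guess such a path. Each square of the
    input also holds a vector with bounded entries, and the weight of the path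
    is kept as the sum of these vectors, spread so that no entry overflows. A
    zero sum is recognized by carrying units between squares until every vector
    is zero. *)

Set Implicit Arguments.
Unset Strict Implicit.
Unset Printing Implicit Defensive.

Import Order.TTheory GRing.Theory Num.Theory.

(** * Small solutions of homogeneous linear systems *)

(** Some index from [n] on minimizes [u] over all indices from [n] on, since [nat] is well ordered.
    Iterating this choice, each time past the previous index, gives [f]. *)
Lemma monotone_subsequence (u : nat -> nat) :
  exists2 f : nat -> nat,
    {homo f : i j / i < j} & {homo u \o f : i j / i <= j}.
Proof.
have [m min_m]: {m : nat -> nat &
    forall n, n <= m n /\ forall j, n <= j -> u (m n) <= u j}.
  apply: (@choice _ _
    (fun n i => n <= i /\ forall j, n <= j -> u i <= u j)) => n.
  have exP : exists v, `[< exists2 i, n <= i & u i = v >].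
    by exists (u n); apply/asboolP; exists n.
  case: (ex_minnP exP) => v /asboolP[i le_ni <-] min_v; exists i.
  split=> // j le_nj.
  by apply: min_v; apply/asboolP; exists j.
pose f := fix f n := if n is n'.+1 then m (f n').+1 else m 0.
have lt_f i : f i < f i.+1 by case: (min_m (f i).+1).
exists f; first exact: (homo_ltn ltn_trans lt_f).
apply: homo_leq => [//|j i k|i /=]; [exact: leq_trans|].
case: i => [|i] /=; first by case: (min_m 0) => _ ->.
case: (min_m (f i).+1) => _; apply.
by apply: leq_trans (lt_f i) _; exact: ltnW (lt_f i.+1).
Qed.

Lemma monotone_subsequence_seq (I : eqType) (r : seq I) (u : nat -> I -> nat) :
  exists2 f : nat -> nat, {homo f : i j / i < j} &
    forall x, x \in r -> {homo (fun n => u (f n) x) : i j / i <= j}.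
Proof.
elim: r => [|x r [f f_mono uf_mono]]; first by exists id.
have [g g_mono ug_mono] := monotone_subsequence (fun n => u (f n) x).
exists (f \o g) => [i j /g_mono/f_mono//|y].
rewrite inE => /predU1P[-> i j /ug_mono//|/uf_mono u_mono i j le_ij].
apply: u_mono; move: le_ij; rewrite leq_eqVlt => /predU1P[->//|/g_mono].
exact: ltnW.
Qed.

(** The bound [N] stands for the finiteness of the set of minimal elements of [P]. If no bound
    works, choose a counterexample [u N] for each [N]; along a subsequence monotone in every
    coordinate, [u (f 0)] lies below all later terms and has a fixed sum, a contradiction. *)
Lemma dickson (I : finType) (P : (I -> nat) -> Prop) :
  exists N, forall h, P h ->
    exists h', [/\ P h', forall i, h' i <= h i & \sum_i h' i <= N].
Proof.
apply: contrapT => noN.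
have [u badu]: {u : nat -> I -> nat & forall N, P (u N) /\
    ~ exists h', [/\ P h', forall i, h' i <= u N i & \sum_i h' i <= N]}.
  apply: (@choice _ _ (fun N h => P h /\
    ~ exists h', [/\ P h', forall i, h' i <= h i & \sum_i h' i <= N])) => N.
  apply: contrapT => no_h; apply: noN; exists N => h Ph.
  by apply: contrapT => no_h'; apply: no_h; exists h.
have [f f_mono u_mono] := monotone_subsequence_seq (enum I) u.
set n := \sum_i u (f 0) i.
have le_f j : j <= f j.
  by elim: j => // j /leq_ltn_trans; apply; apply: f_mono.
case: (badu (f n)) => _; apply; exists (u (f 0)); split=> [|i|//].
  by case: (badu (f 0)).
  by apply: u_mono; rewrite ?mem_enum.
Qed.

Section SmallComplement.
Variable G : zmodType.
Local Open Scope ring_scope.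

(** A small nonzero solution [g] is split off [h], and the rest is treated by induction. If [g]
    vanishes on [D] it is dropped; otherwise it is put back, and its at most [N] units outside [D]
    are charged to at least one unit in [D]. *)
Lemma small_complement_fun (I : finType) (D : pred I) (phi : I -> G) :
  exists N : nat, forall h : I -> nat, \sum_i phi i *+ h i = 0 ->
    exists h' : I -> nat,
      [/\ \sum_i phi i *+ h' i = 0, forall i, D i -> h' i = h i,
          forall i, (h' i <= h i)%N
        & (\sum_(i | ~~ D i) h' i <= N * \sum_(i | D i) h i)%N].
Proof.
have [N min_h] := dickson (fun h : I -> nat =>
  \sum_i phi i *+ h i = 0 /\ exists i, (0 < h i)%N).
exists N => h; have [n] := ubnP (\sum_i h i)%N;
  elim: n h => // n IHn h lt_hn h0.
have [[i hi_gt0]|no_i] := pselect (exists i, (0 < h i)%N); last first.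
  have hE i : h i = 0%N.
    by apply/eqP; rewrite -leqn0 leqNgt; apply/negP => hi; apply: no_i;
      exists i.
  by exists h; split=> //; rewrite big1.
have [|g [[g0 [j gj_gt0]] le_gh le_gN]] := min_h h; first by split;
  last exists i.
pose d i := (h i - g i)%N.
have hE k : h k = (d k + g k)%N by rewrite /d subnK.
have d0 : \sum_i phi i *+ d i = 0.
  move: h0; under eq_bigr do rewrite hE mulrnDr.
  by rewrite big_split /= g0 addr0.
have sumE (Q : pred I) : (\sum_(i | Q i) h i =
    \sum_(i | Q i) d i + \sum_(i | Q i) g i)%N.
  by rewrite -big_split; apply: eq_bigr => k _; rewrite hE.
have [||d' [d'0 eq_d' le_d' small_d']] := IHn d => //.
  have g_gt0 : (0 < \sum_i g i)%N by rewrite (bigD1 j) //= ltn_addr.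
  by rewrite sumE in lt_hn; lia.
have [g_0|] := eqVneq (\sum_(i | D i) g i)%N 0%N.
  exists d'; split=> // [k Dk|k|]; last by rewrite (sumE D) g_0 addn0.
    by rewrite eq_d' // hE; move/eqP: g_0; rewrite sum_nat_eq0 =>
      /forall_inP/(_ k Dk)/eqP->; rewrite addn0.
  by rewrite hE (leq_trans (le_d' k)) ?leq_addr.
rewrite -lt0n => g_gt0; exists (fun k => d' k + g k)%N; split=> [|k Dk|k|].
- under eq_bigr do rewrite mulrnDr.
  by rewrite big_split /= d'0 g0 addr0.
- by rewrite eq_d' // hE.
- by rewrite hE leq_add2r.
rewrite big_split (sumE D) mulnDr leq_add //.
rewrite -[X in (X <= _)%N]muln1 leq_mul //; apply: leq_trans le_gN.
by rewrite [leqRHS](bigID D) /= leq_addl.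
Qed.

Lemma big_count (I : finType) (F : I -> G) (s : seq I) :
  \sum_(i <- s) F i = \sum_i F i *+ count_mem i s.
Proof.
elim: s => [|x s IHs]; first by rewrite big_nil big1.
rewrite big_cons IHs; under [RHS]eq_bigr do rewrite /= mulrnDr.
rewrite big_split; congr (_ + _); rewrite (bigD1 x) //= eqxx mulr1n.
by rewrite big1 ?addr0 // => i; rewrite eq_sym => /negPf->.
Qed.

(** Multiplicities turn [s] and [t] into one solution indexed by [E + C]; since [D] is the side of
    [E], [s] survives unchanged. Later [s] lists skeleton edges and [t] lists loops. *)
Lemma small_complement (E C : finType) (f : E -> G) (g : C -> G) :
  exists N : nat, forall s t,
    \sum_(e <- s) f e + \sum_(c <- t) g c = 0 ->
    exists t', [/\ {subset t' <= t},
      \sum_(e <- s) f e + \sum_(c <- t') g c = 0 & (size t' <= N * size s)%N].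
Proof.
pose D (i : E + C) := if i is inl _ then true else false.
pose phi (i : E + C) := match i with inl e => f e | inr c => g c end.
have [N small] := small_complement_fun D phi; exists N => s t st0.
pose h (i : E + C) := match i with
  inl e => count_mem e s | inr c => count_mem c t end.
have [|h' [h'0 eq_h' le_h' small_h']] := small h.
  by rewrite big_sumType -!big_count.
exists (flatten [seq nseq (h' (inr c)) c | c <- enum C]); split.
- move=> c /flattenP[_ /mapP[c' _ ->]]; rewrite mem_nseq => /andP[h'c /eqP->].
  by rewrite -has_pred1 has_count; apply: leq_trans h'c (le_h' (inr c')).
- move: h'0; rewrite big_sumType /=; under eq_bigr do rewrite eq_h' //=.
  rewrite -big_count big_flatten big_map big_enum => h'0.
  rewrite -[RHS]h'0; congr (_ + _); apply: eq_bigr => c _.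
  by rewrite big_nseq -Monoid.iteropE /=; elim: (h' _) => //= n ->;
    rewrite mulrS.
move: small_h'; rewrite !big_sumType /= !big_pred0_eq add0n addn0.
have -> : (\sum_e count_mem e s = size s)%N.
  under eq_bigr do rewrite -sum1_count.
  rewrite (exchange_big_dep predT) //= -sum1_size; apply: eq_bigr => e _.
  by rewrite (big_pred1 e) // => e'; rewrite /= eq_sym.
rewrite size_flatten /shape -map_comp sumnE big_map.
rewrite big_enum; apply: leq_trans; apply: leq_sum => c _.
by rewrite /= size_nseq.
Qed.

End SmallComplement.

(** * Accepting paths of linear length *)

Section ShortPath.
Variables (G : zmodType) (S : finType).
Variable A : g_automaton (GRing.to_multiplicative G) S.
Implicit Types (q v : vertex A) (p s t c : seq (edge A)).
Local Open Scope ring_scope.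

Definition weight p : G := \sum_(e <- p) (eweight e : G).

Lemma path_weightE p : path_weight p = weight p.
Proof.
elim: p => [|e p IHp]; first by rewrite /path_weight /weight !big_nil.
by rewrite /path_weight /weight !big_cons -[X in (_ * X)%g]/(path_weight p) IHp.
Qed.

Lemma weight_cat p1 p2 : weight (p1 ++ p2) = weight p1 + weight p2.
Proof. exact: big_cat. Qed.

Lemma weight_rcons p e : weight (rcons p e) = weight p + (eweight e : G).
Proof. by rewrite -cats1 weight_cat /weight big_seq1. Qed.

Lemma is_path_cat q p1 p2 q' :
  is_path q (p1 ++ p2) q' <-> exists2 v, is_path q p1 v & is_path v p2 q'.
Proof.
elim: p1 q => [|e p1 IHp1] q /=.
  by split=> [|[v /eqP->]]; first by exists q.
split=> [/andP[-> /IHp1[v p1v vp2]]|[v /andP[-> p1v] vp2]]; first by exists v.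
by apply/IHp1; exists v.
Qed.

Lemma is_path_rcons q p e q' :
  is_path q (rcons p e) q' <-> is_path q p (esrc e) /\ edst e = q'.
Proof.
rewrite -cats1 is_path_cat /=; split=> [[v + /andP[/eqP-> /eqP->]]//|[pe <-]].
by exists (esrc e); rewrite ?eqxx.
Qed.

Lemma path_word_cat p1 p2 : path_word (p1 ++ p2) = path_word p1 ++ path_word p2.
Proof. exact: pmap_cat. Qed.

Definition silent : pred (edge A) := fun e => elabel e == None.

Lemma silent_path_word p : all silent p -> path_word p = [::].
Proof.
by elim: p => //= e p IHp /andP[/eqP + /IHp]; rewrite /path_word /= => ->.
Qed.

Definition visited q p := q :: map (@edst _ _ A) p.

Lemma visited_split q p q' v :
  is_path q p q' -> v \in visited q p ->
  exists p1 p2, [/\ p = p1 ++ p2, is_path q p1 v & is_path v p2 q'].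
Proof.
elim: p q => [|e p IHp] q /=.
  by move=> /eqP<-; rewrite inE => /eqP->; exists [::], [::]; rewrite /= eqxx.
move=> /andP[qe pq']; rewrite inE => /predU1P[->|].
  by exists [::], (e :: p); rewrite /= eqxx qe pq'.
case/(IHp _ pq') => p1 [p2 [-> p1v p2q']].
by exists (e :: p1), p2; rewrite /= qe.
Qed.

Local Notation nv := #|vertex A|.

Lemma size_simple v t : uniq (visited v t) -> (size t < nv)%N.
Proof.
move/card_uniqP; rewrite /= size_map => <-; exact: max_card.
Qed.

Definition loop_in (r : seq (vertex A)) c :=
  all silent c /\ exists2 v, v \in r & is_path v c v.

(* [s] is the committed part of the skeleton: it already meets every vertex that
   [p] meets. It is extended whenever a letter is read or a new vertex is met;
   in between, the silent part [t] is kept simple by removing each loop as soon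
   as it closes. *)
Lemma skeleton q p q' : is_path q p q' ->
  exists v s t (cs : seq (nv.-bseq (edge A))),
    [/\ is_path q s v, is_path v t q', uniq (visited v t) & all silent t] /\
    [/\ path_word s = path_word p, {subset visited q p <= visited q s},
        (size s <= nv * (size (path_word p) + #|visited q s|))%N,
        forall c : nv.-bseq (edge A), c \in cs -> loop_in (visited q s) c
      & weight p = weight s + weight t + \sum_(c <- cs) weight c].
Proof.
elim/last_ind: p q' => [|p e IHp] q'.
  move=> /eqP->; exists q', [::], [::], [::]; split; split=> //.
    by rewrite /= eqxx.
    by rewrite /= eqxx.
  by rewrite /weight !big_nil !addr0.
case/is_path_rcons => /IHp[v [s [t [cs [[qs vt uniq_t t_silent]]]]]] + edst_e.
move=> [ws vis_s size_s loop_cs wp].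
have size_t := size_simple uniq_t.
have path_e : is_path v (rcons t e) q' by apply/is_path_rcons.
have vis_cat r : {subset visited q s <= visited q (s ++ r)}.
  by move=> x; rewrite /visited map_cat -cat_cons mem_cat => ->.
have [commit|] := boolP (~~ silent e || (q' \notin visited q s)).
  exists q', (s ++ rcons t e), [::], cs; split; split=> //.
  - by apply/is_path_cat; exists v.
  - by rewrite /= eqxx.
  - by rewrite -rcons_cat -!cats1 !path_word_cat (silent_path_word t_silent)
      cats0 ws.
  - move=> x; rewrite /visited map_rcons -rcons_cons mem_rcons inE.
    case/predU1P => [->|/vis_s sx]; last exact: vis_cat.
    by rewrite map_cat map_rcons inE mem_cat mem_rcons mem_head !orbT.
  - rewrite size_cat size_rcons.
    have le_vis : (#|visited q s| <= #|visited q (s ++ rcons t e)|)%N.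
      by apply: subset_leq_card; apply/subsetP; apply: vis_cat.
    (* Since [t] is simple, at most [nv] edges are appended to [s], while the number of letters plus
       visited vertices grows. *)
    suff : (size (path_word p) + #|visited q s| <
        size (path_word (rcons p e)) + #|visited q (s ++ rcons t e)|)%N.
      by nia.
    rewrite -cats1 path_word_cat size_cat.
    case/orP: commit => [|new].
      rewrite /silent /path_word /=; case: elabel => //= a _.
      by rewrite -addnA ltn_add2l add1n ltnS.
    suff : (#|visited q s| < #|visited q (s ++ rcons t e)|)%N by lia.
    apply: proper_card; apply/properP; split; first exact/subsetP/vis_cat.
    exists q' => //.
    by rewrite /visited map_cat map_rcons edst_e inE mem_cat mem_rcons mem_head
      !orbT.
  - by move=> c /loop_cs[c_silent [x /vis_cat]]; split=> //; exists x.
  - by rewrite weight_rcons wp weight_cat weight_rcons /weight big_nil addr0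
      addrAC !addrA.
rewrite negb_or !negbK => /andP[e_silent old].
have word_e : path_word (rcons p e) = path_word p.
  by rewrite -cats1 path_word_cat (@silent_path_word [:: e]) /= ?cats0
    ?e_silent.
have vis_e : {subset visited q (rcons p e) <= visited q s}.
  move=> x; rewrite /visited map_rcons -rcons_cons mem_rcons inE edst_e.
  by case/predU1P => [->//|/vis_s].
rewrite word_e; have [in_t|notin_t] := boolP (q' \in visited v t); last first.
  exists v, s, (rcons t e), cs; split; split=> //.
  - by rewrite /visited map_rcons -rcons_cons rcons_uniq edst_e notin_t.
  - by rewrite all_rcons e_silent.
  - by rewrite !weight_rcons wp addrAC !addrA.
(* The edge [e] closes a loop, [t2] followed by [e], at a vertex already visited by [s]; it is short
   since [t] is simple. It goes to [cs], and [t] shrinks to [t1]. *)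
have [t1 [t2 [def_t vt1 t2e]]] := visited_split vt in_t.
have path_c : is_path q' (rcons t2 e) q' by apply/is_path_rcons.
have size_c : (size (rcons t2 e) <= nv)%N.
  by rewrite size_rcons; apply: leq_trans size_t; rewrite def_t size_cat; lia.
move: t_silent uniq_t;
  rewrite def_t all_cat /visited map_cat -cat_cons cat_uniq.
move=> /andP[t1_silent t2_silent] /andP[uniq_t1 _].
exists v, s, t1, (Bseq size_c :: cs); split; split=> //.
- move=> c; rewrite inE => /predU1P[->|/loop_cs//].
  by split; [rewrite all_rcons e_silent|exists q'].
- by rewrite weight_rcons wp def_t weight_cat big_cons weight_rcons !addrA;
    rewrite !(addrAC _ _ (eweight e : G)) (addrAC _ _ (weight t2)).
Qed.

(** Inserting a loop at a visit to its base removes no vertex from the path, so the remaining loops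
    can still be inserted. *)
Lemma insert_loops q p q' (cs : seq (nv.-bseq (edge A))) :
  is_path q p q' -> (forall c : nv.-bseq (edge A), c \in cs ->
    loop_in (visited q p) c) ->
  exists p', [/\ is_path q p' q', path_word p' = path_word p,
    weight p' = weight p + \sum_(c <- cs) weight c
    & (size p' <= size p + nv * size cs)%N].
Proof.
elim: cs p => [|c cs IHcs] p qp loop_cs.
  by exists p; rewrite big_nil addr0 leq_addr.
have [c_silent [v vp vc]] := loop_cs c (mem_head c cs).
have [p1 [p2 [def_p p1v p2q']]] := visited_split qp vp.
have [||p' [qp' wp' weight_p' size_p']] := IHcs (p1 ++ c ++ p2).
- by apply/is_path_cat; exists v => //; apply/is_path_cat; exists v.
- move=> c' cs_c'; have [|c'_silent [x px xc']] := loop_cs c'.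
    by rewrite inE cs_c' orbT.
  split=> //; exists x => //; move: px;
    rewrite def_p /visited !map_cat !inE !mem_cat.
  by case/or3P => ->; rewrite ?orbT.
exists p'; split=> //.
- by rewrite wp' def_p !path_word_cat (silent_path_word c_silent).
- rewrite weight_p' def_p !weight_cat big_cons !addrA.
  by rewrite (addrAC _ (weight c)).
- apply: leq_trans size_p' _; rewrite def_p !size_cat /= mulnS.
  by rewrite addnCA -addnA [leqRHS]addnCA leq_add2r size_bseq.
Qed.

Lemma short_accepting_path : exists K, forall w, g_lang A w ->
  exists p q, [/\ q \in gaccept A, is_path (gstart A) p q, path_word p = w,
    weight p = 0 & (size p <= K * (size w).+1)%N].
Proof.
have [N small] := small_complement (fun e : edge A => eweight e : G)
  (fun c : nv.-bseq (edge A) => weight c).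
(* The skeleton with its silent tail has at most [nv * (nv + 2) * n.+1] edges, [n] being the length
   of the word; at most [N] times as many loops return, each with at most [nv] edges. *)
exists (nv * (nv + 2) * (nv * N).+1)%N => w [p [q [q_acc qp <-]]].
rewrite path_weightE => p0.
have [v [s [t [cs [[qs vt uniq_t t_silent]]]]]] := skeleton qp.
move=> [ws vis_s size_s loop_cs wp].
have [|cs' [sub_cs' cs'0 size_cs']] := small (s ++ t) cs.
  by rewrite -[RHS]p0 wp -weight_cat.
have size_t := size_simple uniq_t.
have [||p' [qp' wp' weight_p' size_p']] :=
  @insert_loops (gstart A) (s ++ t) q cs'.
- by apply/is_path_cat; exists v.
- move=> c /sub_cs'/loop_cs[c_silent [x sx xc]]; split=> //; exists x => //.
  by move: sx; rewrite /visited map_cat -cat_cons mem_cat => ->.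
exists p', q; split=> //.
- by rewrite wp' path_word_cat (silent_path_word t_silent) cats0.
- by rewrite weight_p' -[RHS]cs'0.
have le_vis : (#|visited (gstart A) s| <= nv)%N by exact: max_card.
apply: leq_trans size_p' _; rewrite size_cat in size_cs' *.
set n := size (path_word p) in size_s *.
have le_st : (size s + size t <= nv * (nv + 2) * n.+1)%N.
  apply: (@leq_trans (nv * (n + nv) + nv)); last by nia.
  by apply: leq_add; [apply: leq_trans size_s _;
    rewrite leq_mul2l leq_add2l le_vis orbT|exact: ltnW].
rewrite mulnAC mulnS leq_add // [leqRHS]mulnC -mulnA leq_mul2l.
by rewrite (leq_trans size_cs') ?orbT // leq_mul2l le_st orbT.
Qed.

End ShortPath.

(** * The linear bounded automaton *)

(** [Roam] simulates the automaton while walking over the tape; [Sweep] is the final pass from left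
    to right that verifies the guess. *)
Inductive control (V D : Type) :=
  Init | Accept | Sweep | Roam of V & D & option bool.
Arguments Init {V D}.
Arguments Accept {V D}.
Arguments Sweep {V D}.

Section ControlFinite.
Variables V D : finType.

Definition control_code (s : control V D) :=
  match s with
  | Init => inl (inl tt) | Accept => inl (inr true) | Sweep => inl (inr false)
  | Roam q x d => inr (q, x, d)
  end.

Definition control_decode (s : unit + bool + V * D * option bool) :
    control V D :=
  match s with
  | inl (inl _) => Init | inl (inr true) => Accept | inl (inr false) => Sweep
  | inr (q, x, d) => Roam q x d
  end.

Lemma control_codeK : cancel control_code control_decode.
Proof. by case. Qed.

HB.instance Definition _ := Finite.copy (control V D) (can_type control_codeK).
End ControlFinite.

Section Machine.
Variables (G : zmodType) (S : finType).
Variable A : g_automaton (GRing.to_multiplicative G) S.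
Variables (D : finType) (val : D -> G) (zero : D).
Hypothesis val_zero : val zero = 0%R.
Local Open Scope ring_scope.

Local Notation ctl := (control (vertex A) D).

(** An input letter, whether the simulated path has read it, and a stored share of the weight. The
    letter is never erased, so the tape still determines the input. *)
Definition cell : finType := (pm S * bool * D)%type.
Definition letter (x : cell) := x.1.1.
Definition consumed (x : cell) := x.1.2.
Definition value (x : cell) : G := val x.2.

Notation square := (option cell).

Definition fresh_cell (a : pm S) : cell := (a, false, zero).

(* In [Roam q x d] the register [x] holds a part of the weight of the simulated
   path, which has reached [q], and the cells hold the rest. The flag [d] is
   [None] when the head has just moved left, so that a blank is then the left
   end of the tape, and [Some true] when it has just moved right from the left
   end or from a consumed cell, so that all the cells on its left are consumed.
   A run that leaves the input on the right in a [Roam] state is stuck, so the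
   head scans at most one blank at each end. *)
Inductive rule : ctl -> square -> ctl * square * move -> Prop :=
| RuleEmpty : g_lang A [::] -> rule Init None (Accept, None, Stay)
| RuleStart y :
    rule Init (Some y) (Roam (gstart A) zero (Some true), Some y, Stay)
| RuleLeft q x d y :
    rule (Roam q x d) (Some y) (Roam q x None, Some y, MoveLeft)
| RuleRight q x d y :
    rule (Roam q x d) (Some y) (Roam q x (Some (consumed y)), Some y, MoveRight)
| RuleBounce q x :
    rule (Roam q x None) None (Roam q x (Some true), None, MoveRight)
| RuleExchange q x d a b y x' y' : val x' + val y' = val x + val y ->
    rule (Roam q x d) (Some (a, b, y)) (Roam q x' d, Some (a, b, y'), Stay)
| RuleSilent (e : edge A) x d y x' :
    elabel e = None -> val x' = val x + (eweight e : G) ->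
    rule (Roam (esrc e) x d) (Some y) (Roam (edst e) x' d, Some y, Stay)
| RuleRead (e : edge A) x a y x' :
    elabel e = Some a -> val x' = val x + (eweight e : G) ->
    rule (Roam (esrc e) x (Some true)) (Some (a, false, y))
         (Roam (edst e) x' (Some true), Some (a, true, y), Stay)
| RuleCheck q x : q \in gaccept A -> val x = 0 ->
    rule (Roam q x None) None (Sweep, None, MoveRight)
| RuleSweep a y : val y = 0 ->
    rule Sweep (Some (a, true, y)) (Sweep, Some (a, true, y), MoveRight)
| RuleAccept : rule Sweep None (Accept, None, Stay).

(** Decided classically: a transition table on finite types may be any boolean function. *)
Definition rule_trans (s : ctl) (y : square) (r : ctl * square * move) : bool :=
  `[< rule s y r >].

Lemma fresh_cell_inj : injective (Some \o fresh_cell).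
Proof. by move=> a b []. Qed.

Definition machine : turing_machine (pm S) :=
  @TuringMachine (pm S) ctl square None (Some \o fresh_cell) fresh_cell_inj
    (fun _ => isT) Init [set Accept] rule_trans.

Local Notation config := (config machine).
Local Notation reach := (clos_refl_trans config (@step _ machine)).

(** * Soundness of the machine and its space bound *)

Section Soundness.
Variable w : seq (pm S).

Definition total (t : seq cell) : G := \sum_(y <- t) value y.

(** Here [t] is the whole tape from left to right. The pairwise condition makes the consumed cells a
    prefix, so that the path [p] has read a prefix of [w]. *)
Definition sound q (x : D) (t : seq cell) :=
  [/\ map letter t = w,
      pairwise (fun y z => consumed z ==> consumed y) t
    & exists p, [/\ is_path (gstart A) p q,
        path_word p = map letter (filter consumed t)
      & weight p = val x + total t]].

(** The tape content is [rev l ++ r], and [b] tells whether the left blank has been stored. An empty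
    [r] puts the head on the right blank, where excluding the flag [None] disables [RuleBounce] and
    [RuleCheck]. *)
Inductive invariant : config -> Prop :=
| InvInit : invariant (init_config machine w)
| InvLeftEnd q x t : sound q x t ->
    invariant (@Config _ machine (Roam q x None) [::] None (map Some t))
| InvRoam q x d l (b : bool) r : sound q x (rev l ++ r) ->
    (r = [::] -> d <> None) -> (d = Some true -> all consumed l) ->
    invariant (@Config _ machine (Roam q x d) (map Some l ++ nseq b None)
      (head None (map Some r)) (behead (map Some r)))
| InvSweep q x l r : sound q x (rev l ++ r) -> q \in gaccept A -> val x = 0 ->
    all consumed l -> total l = 0 ->
    invariant (@Config _ machine Sweep (map Some l ++ nseq true None)
      (head None (map Some r)) (behead (map Some r)))
| InvAccept l y r : (size l + 1 + size r <= size w + 2)%N -> g_lang A w ->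
    invariant (@Config _ machine Accept l y r).

Lemma total_cat t1 t2 : total (t1 ++ t2) = total t1 + total t2.
Proof. exact: big_cat. Qed.

Lemma total_cons y t : total (y :: t) = value y + total t.
Proof. exact: big_cons. Qed.

Lemma total_rev t : total (rev t) = total t.
Proof. exact/perm_big/permEl/perm_rev. Qed.

Lemma size_sound q x t : sound q x t -> size t = size w.
Proof. by case=> <- _ _; rewrite size_map. Qed.

Lemma sound_exchange q x x' a b y y' t1 t2 : val x' + val y' = val x + val y ->
  sound q x (t1 ++ (a, b, y) :: t2) -> sound q x' (t1 ++ (a, b, y') :: t2).
Proof.
move=> eq_xy [wE cE [p [qp wp weight_p]]]; split.
- by move: wE; rewrite !map_cat.
- by move: cE; rewrite !pairwise_cat !allrel_consr /=.
- exists p; split=> //.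
    by rewrite wp !filter_cat !map_cat /=; case: (b).
  rewrite weight_p !total_cat !total_cons /value /= addrCA [RHS]addrCA.
  by congr (_ + _); rewrite !addrA eq_xy.
Qed.

Lemma sound_silent (e : edge A) x x' t :
  elabel e = None -> val x' = val x + (eweight e : G) ->
  sound (esrc e) x t -> sound (edst e) x' t.
Proof.
move=> silent_e eq_x' [wE cE [p [qp wp weight_p]]]; split=> //.
exists (rcons p e); split; first exact/is_path_rcons.
  by rewrite -cats1 path_word_cat wp (@silent_path_word _ _ _ [:: e]) ?cats0 //=
    /silent silent_e.
by rewrite weight_rcons weight_p eq_x' addrAC.
Qed.

(** The cell being read is the first unconsumed one, and by the prefix condition nothing after it is
    consumed, so [a] is the next letter of the word read. *)
Lemma sound_read (e : edge A) x x' a y t1 t2 :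
  elabel e = Some a -> val x' = val x + (eweight e : G) -> all consumed t1 ->
  sound (esrc e) x (t1 ++ (a, false, y) :: t2) ->
  sound (edst e) x' (t1 ++ (a, true, y) :: t2).
Proof.
move=> label_e eq_x' t1_cons [wE cE [p [qp wp weight_p]]].
move: cE; rewrite pairwise_cat allrel_consr /= =>
  /and4P[/andP[_ t12] t1_pw t2_new t2_pw].
have t2_0 : filter consumed t2 = [::].
  by apply/eqP; rewrite -[_ == _]negbK -has_filter -all_predC;
    apply: sub_all t2_new => z; rewrite implybF.
split.
- by rewrite -wE !map_cat.
- rewrite pairwise_cat allrel_consr /= t12 t1_pw t2_pw !andbT /=.
  apply/andP; split; first by apply: sub_all t1_cons => z ->.
  by apply/allP => z _; rewrite implybT.
- exists (rcons p e); split; first exact/is_path_rcons.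
    rewrite -cats1 path_word_cat wp !filter_cat !map_cat /= t2_0 /= cats0.
    by rewrite /path_word /= label_e.
  by rewrite weight_rcons weight_p eq_x' !total_cat !total_cons addrAC.
Qed.

Lemma sound_init : sound (gstart A) zero (map fresh_cell w).
Proof.
split; first by rewrite -map_comp -[RHS]map_id; apply: eq_map.
  by elim: w => //= a w' ->; rewrite andbT; apply/allP => z /mapP[b _ ->].
exists [::]; split; first by rewrite /= eqxx.
  by rewrite filter_map (eq_filter (a2 := pred0)) ?filter_pred0.
by rewrite /weight big_nil val_zero add0r /total big_map big1.
Qed.

Lemma init_configE : init_config machine w =
  @Config _ machine Init [::] (head None (map Some (map fresh_cell w)))
    (behead (map Some (map fresh_cell w))).
Proof. by rewrite -map_comp. Qed.

Lemma sound_accept q x t : sound q x t -> q \in gaccept A -> val x = 0 ->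
  all consumed t -> total t = 0 -> g_lang A w.
Proof.
move=> [wE _ [p [qp wp weight_p]]] q_acc x0 t_cons t0.
exists p, q; split=> //; first by rewrite wp (all_filterP t_cons).
by rewrite path_weightE weight_p x0 t0 addr0.
Qed.

Lemma invariant_step c c' : invariant c -> step c c' -> invariant c'.
Proof.
move=> inv_c [s [y [m [/asboolP step_c ->]]]]; move: step_c.
case: inv_c => {c}
  [|q x t snd|q x d l b r snd r_d d_l|q x l r snd q_acc x0 l_cons l0
   |l y' r sz Lw].
- have snd := sound_init; rewrite init_configE.
  case def_t: (map fresh_cell w) snd => [|z r] snd /=; inversion 1; subst.
    have w0 : w = [::].
      by move/(congr1 size): def_t; rewrite size_map => /size0nil.
    by apply: InvAccept => //; rewrite w0.
  exact: (@InvRoam _ _ _ [::] false (z :: r)).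
- inversion 1; subst.
    exact: (@InvRoam _ _ _ [::] true).
  by apply: (@InvSweep q x [::]) => //; apply: big_nil.
- case: r snd r_d => [|y' r] snd r_d /=.
    by inversion 1; subst; have := r_d erefl.
  inversion 1; subst.
  (* From the leftmost cell the head reaches the left blank, whether or not that blank was
     stored. *)
  + case: l snd d_l => [|y'' l] snd d_l /=.
      by case: (b); exact: (@InvLeftEnd q x (y' :: r)).
    apply: (@InvRoam q x None l b (y'' :: y' :: r)) => //.
    by move: snd; rewrite rev_cons cat_rcons.
  + apply: (@InvRoam q x (Some (consumed y')) (y' :: l)) => //.
      by rewrite rev_cons cat_rcons.
    (* If [y'] is consumed, so is every cell before it, by the prefix condition. *)
    case: snd => _; rewrite pairwise_cat allrel_consr all_rev =>
      /and3P[/andP[l_y' _] _ _] _ [y'_cons].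
    by rewrite /= y'_cons in l_y' *.
  + apply: (@InvRoam q x' d l b (_ :: r)) => //.
    by apply: sound_exchange; eassumption.
  + apply: (@InvRoam _ x' d l b (y' :: r)) => //.
    by apply: sound_silent; eassumption.
  + apply: (@InvRoam _ x' _ l b (_ :: r)) => //.
    by apply: sound_read; try eassumption; rewrite all_rev; apply: d_l.
- case: r snd => [|y' r] snd /=; inversion 1; subst.
    apply: InvAccept.
      by rewrite size_cat size_map -(size_sound snd) cats0 size_rev addn0
        -addnA.
    apply: (sound_accept snd) => //; rewrite cats0 ?all_rev //.
    by rewrite total_rev.
  apply: (@InvSweep q x (_ :: l)) => //.
    by rewrite rev_cons cat_rcons.
  by rewrite total_cons l0 addr0.
- by inversion 1.
Qed.

Lemma invariant_reachable c : reachable w c -> invariant c.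
Proof.
rewrite /reachable; move: InvInit; move: (init_config _ _) => c0 + reach_c.
elim: reach_c => [c1 c2 ? /invariant_step| |c1 c2 c3 _ IH1 _ IH2 /IH1/IH2];
  by auto.
Qed.

Lemma invariant_squares c : invariant c -> (squares c <= 3 * maxn 1 (size w))%N.
Proof.
(* The 2 counts one blank at each end; the factor 3 is exact for a word of one letter. *)
have le3 n : (n <= size w + 2 -> n <= 3 * maxn 1 (size w))%N by lia.
case=> [|q x t snd|q x d l b r snd _ _|q x l r snd _ _ _ _|l y r sz _];
  rewrite /squares /=.
- by rewrite size_behead size_map; lia.
- by apply: le3; rewrite size_map (size_sound snd); lia.
- apply: le3; rewrite -(size_sound snd) !size_cat size_rev size_behead !size_map
    size_nseq.
  by set m := size l; set n := size r; case: b; lia.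
- apply: le3; rewrite -(size_sound snd) !size_cat size_rev size_behead !size_map
    /=.
  by set m := size l; set n := size r; lia.
- exact: le3.
Qed.

Lemma invariant_accept c : invariant c -> cur_state c = Accept -> g_lang A w.
Proof. by case. Qed.

End Soundness.

(** The configuration between simulated steps: the head rests on the left blank, with the flag that
    lets it bounce. *)
Definition home q x t : config :=
  @Config _ machine (Roam q x None) [::] None (map Some t).

Lemma reach_rule (c : config) (s : ctl) (y : square) m :
  rule (cur_state c) (scanned c) (s, y, m) -> reach c (update c s y m).
Proof.
by move=> r; apply: rt_step; exists s, y, m; split=> //; apply/asboolP.
Qed.

Definition at_cell q x d t1 y t2 : config :=
  @Config _ machine (Roam q x d) (map Some (rev t1) ++ [:: None]) (Some y)
    (map Some t2).

(** The default [true] of [last] is the flag set by [RuleBounce]; afterwards each cell passed sets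
    it. *)
Lemma reach_cell q x t1 y t2 : reach (home q x (t1 ++ y :: t2))
  (at_cell q x (Some (last true (map consumed t1))) t1 y t2).
Proof.
elim/last_ind: t1 y t2 => [|t1 z IHt1] y t2.
  exact: (@reach_rule (home q x (y :: t2)) _ _ _ (RuleBounce q x)).
rewrite cat_rcons; apply: rt_trans (IHt1 z (y :: t2)) _.
rewrite map_rcons last_rcons /at_cell rev_rcons.
exact: (@reach_rule (at_cell q x _ t1 z (y :: t2)) _ _ _ (RuleRight q x _ z)).
Qed.

Lemma reach_home q x d t1 y t2 :
  reach (at_cell q x d t1 y t2) (home q x (t1 ++ y :: t2)).
Proof.
elim/last_ind: t1 d y t2 => [|t1 z IHt1] d y t2.
  exact: (@reach_rule (at_cell q x d [::] y t2) _ _ _ (RuleLeft q x d y)).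
rewrite cat_rcons; apply: rt_trans (IHt1 None z (y :: t2)).
have := @reach_rule (at_cell q x d (rcons t1 z) y t2) _ _ _ (RuleLeft q x d y).
by rewrite /at_cell rev_rcons.
Qed.

Lemma reach_exchange q x x' a b y y' t1 t2 :
  val x' + val y' = val x + val y ->
  reach (home q x (t1 ++ (a, b, y) :: t2)) (home q x' (t1 ++ (a, b, y') :: t2)).
Proof.
move=> eq_xy; apply: rt_trans (reach_cell _ _ _ _ _) _.
set d := Some _; apply: rt_trans (reach_home q x' d t1 _ t2).
exact: (@reach_rule (at_cell q x d t1 (a, b, y) t2) _ _ _
  (RuleExchange q d a b eq_xy)).
Qed.

(** [RuleSilent] fires only on a cell, hence the condition on [t]; the first cell serves. *)
Lemma reach_silent (e : edge A) x x' t :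
  elabel e = None -> val x' = val x + (eweight e : G) -> t <> [::] ->
  reach (home (esrc e) x t) (home (edst e) x' t).
Proof.
move=> silent_e eq_x'; case: t => // y t _.
apply: rt_trans (reach_cell _ _ [::] y t) _.
set d := Some _; apply: rt_trans (reach_home _ x' d [::] y t).
exact: (@reach_rule (at_cell _ x d [::] y t) _ _ _
  (RuleSilent d y silent_e eq_x')).
Qed.

Lemma reach_read (e : edge A) x x' a y t1 t2 :
  elabel e = Some a -> val x' = val x + (eweight e : G) -> all consumed t1 ->
  reach (home (esrc e) x (t1 ++ (a, false, y) :: t2))
        (home (edst e) x' (t1 ++ (a, true, y) :: t2)).
Proof.
move=> label_e eq_x' t1_cons; apply: rt_trans (reach_cell _ _ _ _ _) _.
have -> : last true (map consumed t1) = true.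
  by elim/last_ind: t1 t1_cons => // t1 z _;
    rewrite map_rcons last_rcons all_rcons => /andP[].
apply: rt_trans (reach_home _ x' (Some true) t1 _ t2).
exact: (@reach_rule (at_cell _ x (Some true) t1 _ t2) _ _ _
  (RuleRead y label_e eq_x')).
Qed.

Lemma reach_start w : w <> [::] ->
  reach (init_config machine w) (home (gstart A) zero (map fresh_cell w)).
Proof.
case: w => // a w _.
apply: rt_trans (@reach_rule (init_config machine (a :: w)) _ _ _
  (RuleStart (fresh_cell a))) _.
rewrite /home map_cons /= -map_comp.
exact: (@reach_rule (@Config _ machine _ [::] (Some (fresh_cell a))
  (map (Some \o fresh_cell) w)) _ _ _ (RuleLeft _ _ _ (fresh_cell a))).
Qed.

Lemma reach_accept q x t : q \in gaccept A -> val x = 0 ->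
  all consumed t -> (forall y, y \in t -> value y = 0) ->
  exists2 c, reach (home q x t) c & cur_state c = Accept.
Proof.
move=> q_acc x0 t_cons t0.
have [c sweep_c c_acc] : exists2 c, reach (@Config _ machine Sweep [:: None]
    (head None (map Some t)) (behead (map Some t))) c & cur_state c = Accept.
  (* The tape on the left grows during the sweep, so it is generalized. *)
  elim: t [:: None] t_cons t0 => [|[[a b] y] t IHt] l /=.
    move=> _ _; eexists;
      first exact: (@reach_rule (@Config _ machine Sweep l None [::]) _ _ _
        RuleAccept).
    by [].
  case: b => // t_cons t0.
  have [|c sweep_c c_acc] := IHt (Some (a, true, y) :: l) t_cons.
    by move=> z t_z; apply: t0; rewrite inE t_z orbT.
  exists c => //; apply: rt_trans sweep_c.
  apply: (@reach_rule (@Config _ machine Sweep l (Some (a, true, y))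
    (map Some t)) _ _ _ (RuleSweep a _)).
  exact: (t0 _ (mem_head _ _)).
exists c => //; apply: rt_trans sweep_c.
exact: (@reach_rule (home q x t) _ _ _ (RuleCheck q_acc x0)).
Qed.

Lemma machine_linear_bounded : linear_bounded machine.
Proof. by exists 3 => w c /invariant_reachable/invariant_squares. Qed.

Lemma machine_sound w : tm_lang machine w -> g_lang A w.
Proof.
case=> c [/invariant_reachable inv_c]; rewrite inE => /eqP.
exact: invariant_accept.
Qed.

(** The empty input offers no cell to hold a weight, so the answer for it is built into the
    transition table by [RuleEmpty]. *)
Lemma machine_empty : g_lang A [::] -> tm_lang machine [::].
Proof.
move=> A_nil; exists (@Config _ machine Accept [::] None [::]).
split; last by rewrite inE.
exact: (@reach_rule (init_config machine [::]) _ _ _ (RuleEmpty A_nil)).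
Qed.
End Machine.

(** * Simulation of a path *)

Lemma map_eq_cat (T U : Type) (f : T -> U) t s1 s2 : map f t = s1 ++ s2 ->
  exists t1 t2, [/\ t = t1 ++ t2, map f t1 = s1 & map f t2 = s2].
Proof.
move=> ft; exists (take (size s1) t), (drop (size s1) t).
by rewrite cat_take_drop map_take map_drop ft take_size_cat ?drop_size_cat.
Qed.

(** * Integer vectors with bounded entries *)

Section Vectors.
Variables (k B : nat).
Local Open Scope ring_scope.
Local Notation vec := 'rV[int]_k.
Local Notation digits := 'rV['I_B.*2.+1]_k.

Definition norm (v : vec) : nat := (\sum_j `|v 0%R j|)%N.

Lemma norm_ge (v : vec) j : (`|v 0%R j| <= norm v)%N.
Proof. by rewrite /norm (bigD1 j) //= leq_addr. Qed.

Lemma normD (u v : vec) : (norm (u + v) <= norm u + norm v)%N.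
Proof.
rewrite /norm -big_split leq_sum //= => j _; rewrite mxE.
by move: (u 0%R j) (v 0%R j) => a b; lia.
Qed.

Lemma norm0 : norm 0 = 0%N.
Proof. by rewrite /norm big1 // => j _; rewrite mxE. Qed.

(** Digits from 0 to [2B] are shifted to the integers from [-B] to [B], so that cells range over a
    finite type. *)
Definition decode (x : digits) : vec := \row_j ((x 0%R j : nat)%:Z - B%:Z).

Lemma decode_small x j : (`|decode x 0%R j| <= B)%N.
Proof. by rewrite mxE; have := ltn_ord (x 0%R j); lia. Qed.

Lemma decode_ex (v : vec) : (forall j, `|v 0%R j| <= B)%N ->
  exists x, decode x = v.
Proof.
move=> small; exists (\row_j inord `|(v 0%R j + B%:Z)%R|%N).
by apply/rowP => j; rewrite !mxE inordK; have := small j; lia.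
Qed.

Lemma decode_norm (v : vec) : (norm v <= B)%N -> exists x, decode x = v.
Proof. by move=> le_vB; apply: decode_ex => j;
  apply: leq_trans (norm_ge v j) le_vB. Qed.

(** Coordinate [j], of sign [s], moves one unit towards zero and therefore remains representable. *)
Lemma decode_dec (y : digits) (s : int) j : s = 1 \/ s = -1 ->
  0 < s * decode y 0%R j ->
  exists y', decode y' = decode y - s *: delta_mx 0%R j /\
    (norm (decode y') < norm (decode y))%N.
Proof.
move=> s1 sy_gt0; set v := decode y in sy_gt0 *.
set v' := v - _.
have v'E i : v' 0%R i = if i == j then v 0%R j - s else v 0%R i.
  by rewrite !mxE eqxx eq_sym /=; case: eqP => [->|_];
    rewrite ?mulr1 ?mulr0 ?subr0.
have [i|y' def_y'] := @decode_ex v'.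
  have := decode_small y j; have := decode_small y i; rewrite -/v v'E.
  by case: eqP => _ //; case: s1 sy_gt0 => ->; lia.
exists y'; rewrite def_y'; split=> //.
rewrite /norm (bigD1 j) //= [ltnRHS](bigD1 j) //= v'E eqxx.
rewrite (eq_bigr (fun i => `|v 0%R i|%N)) => [|i /negPf neq_ij]; last first.
  by rewrite v'E neq_ij.
by rewrite ltn_add2r; case: s1 sy_gt0 => ->; lia.
Qed.

End Vectors.

Section Simulation.
Variables (k : nat) (S : finType).
Variable A : g_automaton (GRing.to_multiplicative 'rV[int]_k) S.
Variables M B : nat.
Local Open Scope ring_scope.

Definition max_norm : nat :=
  (\max_(e : edge A) norm (eweight e : 'rV[int]_k))%N.

(** A path with at most [M] edges per cell puts an average norm of at most [max_norm * M] on the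
    cells, so some cell always has room for one more edge weight. *)
Hypothesis B_large : (max_norm * M.+1 < B)%N.
Local Notation digits := 'rV['I_B.*2.+1]_k.
Local Notation dec := (@decode k B).
Local Notation cell := (cell S digits).
Local Notation total := (@total _ S digits dec).
Local Notation value := (@value _ S digits dec).
Implicit Types (t : seq cell) (q : vertex A).

Definition zero_digits : digits := const_mx (inord B).

Lemma decode_zero : dec zero_digits = 0.
Proof. by apply/rowP => j;
  rewrite !mxE inordK ?subrr // -addnn ltnS leq_addr. Qed.

Definition counter_machine := machine A dec zero_digits.

Local Notation reach := (clos_refl_trans _ (@step _ counter_machine)).
Local Notation home := (@home _ S A digits dec zero_digits).

Definition load t : nat := (\sum_(y <- t) norm (value y))%N.

(** Pigeonhole: if every cell had norm above [max_norm * M], the load would be too large. A lighter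
    cell takes the content of the register without overflow. *)
Lemma reach_place q x t :
  (norm (dec x) <= max_norm)%N -> (load t < size t * (max_norm * M).+1)%N ->
  exists t', [/\ reach (home q x t) (home q zero_digits t'),
    map fst t' = map fst t, total t' = total t + dec x
    & (load t' <= load t + max_norm)%N].
Proof.
move=> small_x light; have [[[a b] y] t_y small_y] :
    exists2 y, y \in t & (norm (value y) <= max_norm * M)%N.
  apply/hasP; apply/negPn/negP => /hasPn heavy; move: light; rewrite ltnNge =>
    /negP; apply.
  rewrite /load; elim: t heavy => [|y t IHt] heavy; first by rewrite big_nil.
  rewrite big_cons mulSn leq_add ?IHt //;
    first by rewrite ltnNge heavy ?mem_head.
  by move=> z t_z; rewrite heavy ?inE ?t_z ?orbT.
case/splitPr: t_y light => t1 t2 _.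
have [|y' def_y'] := @decode_norm k B (dec y + dec x).
  apply: leq_trans (normD _ _) (leq_trans _ (ltnW B_large)).
  by rewrite mulnS addnC leq_add.
exists (t1 ++ (a, b, y') :: t2); split.
- by apply: reach_exchange; rewrite def_y' decode_zero add0r addrC.
- by rewrite !map_cat.
- by rewrite !total_cat !total_cons {1}/value /= def_y' -!addrA;
    congr (_ + (_ + _)); rewrite addrC.
rewrite /load !big_cat !big_cons /= -addnA leq_add2l addnAC leq_add2r.
by rewrite {1}/value /= def_y'; apply: leq_trans (normD _ _) _;
  rewrite leq_add2l.
Qed.

Lemma total_coord t j : total t 0 j = \sum_(y <- t) value y 0 j.
Proof. by rewrite /total summxE. Qed.

(* A unit of a nonzero coordinate is carried to a cell where that coordinate has
   the opposite sign; such a cell exists because the total is zero. *)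
Lemma reach_drain q t : total t = 0 ->
  exists t', [/\ reach (home q zero_digits t) (home q zero_digits t'),
    map fst t' = map fst t & forall y, y \in t' -> value y = 0].
Proof.
have [n] := ubnP (load t); elim: n t => // n IHn t lt_tn t0.
have [drained|] := boolP (all (fun y => value y == 0) t).
  by exists t; split=> [||y /(allP drained)/eqP //]; first exact: rt_refl.
case/allPn => -[[a b] y] t_y y_neq0.
have [j yj_neq0] : exists j, dec y 0 j != 0.
  apply/existsP; rewrite -negb_forall; apply: contra y_neq0 => /forallP y0.
  by apply/eqP/rowP => j; rewrite [RHS]mxE; apply/eqP.
pose s : int := Num.sg (dec y 0 j).
have s1 : s = 1 \/ s = -1 by rewrite /s; case: sgrP yj_neq0 => [|_ _|_ _];
  rewrite ?eqxx //; [left|right].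
have sN1 : - s = 1 \/ - s = -1 by case: s1 => ->; [right|left].
have sy_gt0 : 0 < s * dec y 0 j by rewrite -normrEsg normr_gt0.
have [y' [def_y' lt_y']] := decode_dec s1 sy_gt0.
have [|x def_x] := @decode_ex k B (s *: delta_mx 0 j).
  move=> i; rewrite !mxE eqxx /=; case: (i == j); case: s1 => ->; lia.
case/splitPr: t_y lt_tn t0 => t1 t2 lt_tn t0.
(* One unit of coordinate [j] moves from the cell to the register. *)
have step1 : reach (home q zero_digits (t1 ++ (a, b, y) :: t2))
    (home q x (t1 ++ (a, b, y') :: t2)).
  by apply: reach_exchange; rewrite def_x def_y' decode_zero add0r addrC subrK.
have total1 : total (t1 ++ (a, b, y') :: t2) = - s *: delta_mx 0 j.
  rewrite scaleNr; apply/eqP; rewrite -addr_eq0 -[X in _ == X]t0; apply/eqP.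
  rewrite !total_cat !total_cons {1}/value /= def_y' -!addrA; congr (_ + _).
  by rewrite [X in _ + (_ + X)]addrC addKr.
have load1 : (load (t1 ++ (a, b, y') :: t2) < load (t1 ++ (a, b, y) :: t2))%N.
  by rewrite /load !big_cat !big_cons /= ltn_add2l ltn_add2r.
have map1 : map fst (t1 ++ (a, b, y') :: t2) = map fst (t1 ++ (a, b, y) :: t2).
  by rewrite !map_cat.
move: (t1 ++ (a, b, y') :: t2) step1 total1 load1 map1 =>
  t' step1 total1 load1 map1.
(* The cells now sum to minus that unit, so in some cell coordinate [j] has the sign of [- s]. *)
have [[[c d] z] t'_z sz_gt0] : exists2 z, z \in t' & 0 < - s * value z 0 j.
  apply/hasP; apply/negPn/negP => /hasPn no_z.
  have : - s * total t' 0 j <= 0.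
    rewrite total_coord mulr_sumr big_seq; apply: sumr_le0 => z t'_z.
    by rewrite leNgt no_z.
  by rewrite total1 !mxE !eqxx mulr1; case: s1 => ->.
(* Absorbing the unit of the register there brings that coordinate closer to zero, so the load does
   not rise again. *)
have [z' [def_z' lt_z']] := decode_dec sN1 sz_gt0.
case/splitPr: t'_z step1 total1 load1 map1 => t3 t4 step1 total1 load1 map1.
have [||t'' [reach_t'' map_t'' t''0]] := IHn (t3 ++ (c, d, z') :: t4).
- apply: leq_trans (leq_trans load1 lt_tn).
  by rewrite ltnS /load !big_cat !big_cons /= leq_add2l leq_add2r ltnW.
- rewrite -[RHS](addNr (s *: delta_mx 0 j)) -scaleNr -total1.
  rewrite !total_cat !total_cons {1}/value /= def_z' scaleNr opprK -!addrA;
    congr (_ + (_ + _)).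
  by rewrite addrC.
exists t''; split=> //.
  apply: rt_trans step1 _; apply: rt_trans reach_t''; apply: reach_exchange.
  by rewrite decode_zero add0r def_z' def_x scaleNr opprK addrC.
by rewrite map_t'' -map1 !map_cat.
Qed.

Definition marked (u v : seq (pm S)) : seq (pm S * bool) :=
  [seq (a, true) | a <- u] ++ [seq (a, false) | a <- v].

Lemma size_marked u v t : map fst t = marked u v -> size t = size (u ++ v).
Proof. by move/(congr1 size); rewrite size_map !size_cat !size_map. Qed.

(** Each edge is simulated from a zero register, and its weight is then placed in a light cell. The
    unread suffix [v] stays general for the induction on the last edge. *)
Lemma reach_path p q w v : w <> [::] -> is_path (gstart A) p q ->
  path_word p ++ v = w -> (size p <= M * size w)%N ->
  exists t, [/\ reach (init_config counter_machine w) (home q zero_digits t),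
    map fst t = marked (path_word p) v, total t = weight p
    & (load t <= max_norm * size p)%N].
Proof.
move=> w_neq0; elim/last_ind: p q v => [|p e IHp] q v.
  move=> /= /eqP<- def_w _; exists (map (fresh_cell zero_digits) w); split.
  - exact: reach_start.
  - by rewrite -map_comp -def_w.
  - by rewrite /weight big_nil /total big_map big1 // => a _;
      apply: decode_zero.
  - by rewrite /load big_map big1 // => a _;
      rewrite /value /= decode_zero norm0.
move=> /is_path_rcons[qp <-]; rewrite size_rcons => def_w lt_pM.
have [x def_x] : exists x, dec x = eweight e :> 'rV_k.
  apply: decode_norm; apply: leq_trans (ltnW B_large); rewrite mulnS.
  by apply: leq_trans (leq_addr _ _); apply: leq_bigmax.
have [t [reach_t mark_t total_t load_t]] : exists t,
    [/\ reach (init_config counter_machine w) (home (edst e) x t),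
    map fst t = marked (path_word (rcons p e)) v, total t = weight p
    & (load t <= max_norm * size p)%N].
  move: (def_w); rewrite -cats1 path_word_cat.
  case label_e: (elabel e) => [a|];
    rewrite /= /path_word /= label_e /= ?cats0 -?catA.
    move=> /(IHp _ _ qp)[|t [reach_t mark_t total_t load_t]]; first exact: ltnW.
    (* Before this edge the unread letters begin with [a], so the first unmarked cell holds it. *)
    have [t1 [t2 [def_t mark_t1]]] := map_eq_cat mark_t.
    case: t2 def_t => // -[[a' b] y] t2 def_t [/= def_a def_b mark_t2];
      subst a' b.
    exists (t1 ++ (a, true, y) :: t2); split.
    - apply: rt_trans reach_t _; rewrite def_t; apply: reach_read => //.
        by rewrite decode_zero add0r.
      by apply/allP => z /(map_f fst); rewrite mark_t1 => /mapP[a' _];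
        rewrite /consumed => ->.
    - by rewrite map_cat /= mark_t1 mark_t2 /marked map_cat -catA.
    - by rewrite -total_t def_t !total_cat !total_cons.
    - by apply: leq_trans load_t; rewrite def_t /load !big_cat !big_cons.
  move=> def_pv; have [|t [reach_t mark_t total_t load_t]] := IHp _ _ qp def_pv.
    exact: ltnW.
  exists t; split=> //; apply: rt_trans reach_t _; apply: reach_silent => //.
    by rewrite decode_zero add0r.
  by move=> t0; apply/w_neq0/size0nil; rewrite -def_pv -(size_marked mark_t) t0.
have [||t' [reach_t' mark_t' total_t' load_t']] := @reach_place (edst e) x t.
- by rewrite def_x; apply: leq_bigmax.
(* The load is at most [max_norm * M] per cell on average, strictly below the pigeonhole
   threshold. *)
- rewrite (size_marked mark_t) def_w mulnS mulnCA.
  have w_gt0 : (0 < size w)%N by case: (w) w_neq0.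
  by rewrite -addn1 addnC leq_add // (leq_trans load_t) // leq_mul2l ltnW ?orbT
    // mulnC.
exists t'; split.
- exact: rt_trans reach_t reach_t'.
- by rewrite mark_t'.
- by rewrite total_t' total_t def_x weight_rcons.
- by apply: leq_trans load_t' _; rewrite mulnS addnC leq_add2l.
Qed.

(** After the path has been simulated, the cells sum to its weight, which is zero; they can be
    drained, and the sweep succeeds. *)
Lemma counter_machine_complete w p q : w <> [::] -> q \in gaccept A ->
  is_path (gstart A) p q -> path_word p = w -> weight p = 0 ->
  (size p <= M * size w)%N -> tm_lang counter_machine w.
Proof.
move=> w_neq0 q_acc qp def_w p0 size_p.
have [|t [reach_t mark_t total_t _]] :=
    reach_path (v := [::]) w_neq0 qp _ size_p.
  by rewrite cats0.
have [|t' [reach_t' mark_t' t'0]] := @reach_drain q t; first by rewrite total_t.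
have [|c reach_c c_acc] :=
    @reach_accept _ _ A _ dec zero_digits q zero_digits t' q_acc decode_zero _
      t'0.
  apply/allP => z /(map_f fst); rewrite mark_t' mark_t /marked cats0.
  by case/mapP => a _; rewrite /consumed => ->.
exists c; split; last by rewrite c_acc inE.
by apply: rt_trans reach_t _; apply: rt_trans reach_t' reach_c.
Qed.

End Simulation.

Theorem corollary6 (S : finType) (L : language (pm S)) :
  counter L -> context_sensitive L.
Proof.
case=> k [_ [A' LA]].
pose A : g_automaton (GRing.to_multiplicative 'rV[int]_k) S := A'.
have [K short] := short_accepting_path A.
(* For nonempty [w], [K * (size w).+1] is at most [K.*2 * size w]; [B] is the least value allowed by
   [B_large]. *)
pose M := K.*2; pose B := (max_norm A * M.+1).+1.
exists (counter_machine A B); split.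
  exact: machine_linear_bounded (decode_zero k B).
move=> w; split=> [/LA Aw|]; last by move/(machine_sound (decode_zero k B))/LA.
have [w0|/eqP w_neq0] := eqVneq w [::]; first by rewrite w0 in Aw *;
  apply: machine_empty.
have [p [q [q_acc qp wp p0 size_p]]] := short w Aw.
apply: (@counter_machine_complete k S A M B _ w p q) => //.
apply: leq_trans size_p _; rewrite /M -muln2 -mulnA leq_mul2l mul2n -addnn.
by case: (w) w_neq0 => // a w' _; rewrite /= addSn addnS !ltnS leq_addr orbT.
Qed.
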